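(* There is a constant $b$ such that for all sufficiently large $n$, $$\frac{1}{n+1}\le \mathcal{D}(L_{n},1) \leq \left( 1 + \frac{b \ln \ln n}{\ln n} \right) \frac{1}{n+1}.$$
   Context: $L_n$ denotes the $n$-dimensional lattice graph: its vertex set is $\mathbb{Z}^n$, and $\{(x_1,\ldots,x_n),(y_1,\ldots,y_n)\}$ is an edge if and only if $\sum_{i=1}^n |x_i-y_i|=1$. For a connected undirected graph $G$ with graph distance $d$, put $B_r(v)=\{u\in V(G): d(u,v)\le r\}$. A code is a nonempty subset $C\subseteq V(G)$. A code $C$ is $r$-identifying if (1) $B_r(v)\cap C\neq\emptyset$ for all $v\in V(G)$, and (2) $B_r(u)\cap C\ne B_r(v)\cap C$ for all $u\neq v$ in $V(G)$. The density of a code $C$ in $L_n$ is $\limsup_{m\to\infty} |C\cap Q_m|/|Q_m|$, where $Q_m$ is the set of $(x_1,\ldots,x_n)\in\mathbb{Z}^n$ with $|x_i|\le m$ for all $i$. $\mathcal{D}(L_n,r)$ denotes the minimum possible density (the infimum over all $r$-identifying codes) of an $r$-identifying code for $L_n$; here $r=1$. *)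

(* Defs.v *)
From HB Require Import structures.
From mathcomp Require Import all_boot all_order all_algebra finmap.
From mathcomp Require Import all_classical all_reals all_analysis.
From mathcomp Require Import zify.

Set Implicit Arguments.
Unset Strict Implicit.
Unset Printing Implicit Defensive.
Import Order.TTheory GRing.Theory Num.Theory.

Local Open Scope classical_set_scope.
Local Open Scope ring_scope.

Record connGraph := ConnGraph {
  vertex :> choiceType;
  edge : rel vertex;
  edge_sym : symmetric edge;
  edge_irr : irreflexive edge;
  edge_conn : forall u v : vertex, exists2 p, path edge u p & last u p = v
}.

Definition walk (G : connGraph) (u v : G) (k : nat) : Prop :=
  exists p : seq G, [/\ path (@edge G) u p, last u p = v & size p = k].

Lemma ex_walk (G : connGraph) (u v : G) : exists k, `[< walk u v k >].
Proof.
have [p pp lp] := edge_conn u v.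
by exists (size p); apply/asboolP; exists p.
Qed.

Definition gdist (G : connGraph) (u v : G) : nat := ex_minn (ex_walk u v).

Definition gball (G : connGraph) (r : nat) (v : G) : set G :=
  [set u | (gdist u v <= r)%N].

Definition code (G : connGraph) (C : set G) : Prop := C !=set0.

Definition identifying (G : connGraph) (r : nat) (C : set G) : Prop :=
  [/\ code C,
      (forall v : G, gball r v `&` C !=set0) &
      (forall u v : G, u <> v -> gball r u `&` C <> gball r v `&` C)].

Definition lattice_edge (n : nat) : rel {ffun 'I_n -> int} :=
  fun x y => \sum_(i < n) `|x i - y i| == 1.

Lemma lattice_edge_sym n : symmetric (@lattice_edge n).
Proof.
by move=> x y; rewrite /lattice_edge; under eq_bigr do rewrite distrC.
Qed.

Lemma lattice_edge_irr n : irreflexive (@lattice_edge n).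
Proof.
by move=> x; rewrite /lattice_edge big1// => i _; rewrite subrr normr0.
Qed.

Lemma lattice_edge_conn n (x y : {ffun 'I_n -> int}) :
  exists2 p, path (@lattice_edge n) x p & last x p = y.
Proof.
have [k] := ubnP (\sum_(i < n) `|x i - y i|)%N.
elim: k => // k IH in x *; rewrite ltnS => le_k.
have [->|/eqP ne] := eqVneq x y; first by exists [::].
have [i ni] : exists i, x i != y i.
  apply/existsP; rewrite -negb_forall; apply/negP => /forallP h.
  by apply: ne; apply/ffunP => i; apply/eqP.
pose x' : {ffun 'I_n -> int} :=
  [ffun j => if j == i then (if x i < y i then x i + 1 else x i - 1) else x j].
have exx' : lattice_edge x x'.
  rewrite /lattice_edge (bigD1 i)//= big1 ?ffunE ?eqxx; last first.
    by move=> j /negPf ji; rewrite ffunE ji subrr normr0.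
  by case: ifP => _; lia.
have [|p pp lp] := IH x'.
  apply: leq_trans le_k; rewrite (bigD1 i)// [leqRHS](bigD1 i)//=.
  under eq_bigr => j /negPf ji do rewrite ffunE ji.
  rewrite -addSn leq_add2r ffunE eqxx.
  by move: ni; case: ifP => h1 h2; lia.
by exists (x' :: p); rewrite //= exx'.
Qed.

Definition lattice (n : nat) : connGraph :=
  ConnGraph (@lattice_edge_sym n) (@lattice_edge_irr n) (@lattice_edge_conn n).

Definition cube (n m : nat) : set (lattice n) :=
  [set x : {ffun 'I_n -> int} | forall i, `|x i| <= m%:Z].
Arguments cube : clear implicits.

(* [fset_set] sends infinite sets to [fset0], hence this check. *)
Lemma finite_cube n m : finite_set (cube n m).
Proof.
pose f (t : {ffun 'I_n -> 'I_(m.*2.+1)}) : {ffun 'I_n -> int} :=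
  [ffun i => (t i)%:Z - m%:Z].
apply: (@sub_finite_set _ _ (f @` setT)).
  move=> x /= xm; exists [ffun i => inord (absz (x i + m%:Z))] => //.
  apply/ffunP => i; rewrite !ffunE.
  move: (x i) (xm i) => z h.
  by rewrite inordK; lia.
exact/finite_image/finite_finset.
Qed.

Definition density (R : realType) (n : nat) (C : set (lattice n)) : \bar R :=
  limn_esup (fun m : nat =>
    ((#|` fset_set (C `&` cube n m)|)%:R / (#|` fset_set (cube n m)|)%:R)%:E).

(* Valued in [\bar R], where the infimum of the empty set is [+oo]. *)
Definition min_density (R : realType) (n r : nat) : \bar R :=
  ereal_inf [set density R C | C in [set C : set (lattice n) | identifying r C]].

(* Main.v *)
From HB Require Import structures.
Require Import Defs.
From mathcomp Require Import all_boot all_order all_algebra all_field finmap.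
From mathcomp Require Import all_classical all_reals all_analysis.
From mathcomp Require Import zify ring lra.
Import Order.TTheory GRing.Theory Num.Theory.
Import numFieldNormedType.Exports.

Set Implicit Arguments.
Unset Strict Implicit.
Unset Printing Implicit Defensive.

(* Lower bound: a ball has 2n+1 elements, and every vertex is covered at least twice,
   except at most one vertex per codeword, so |C| (2n+2) >= 2 |Q| up to boundary effects.

   Upper bound: the preimage in Z^n, by reduction mod 2, of a dominating set of the
   hypercube is 1-identifying, because a vertex outside of it has both v - e_i and v + e_i
   in it for some i, and no other ball contains both. Thin dominating sets come from an
   abelian group G covered by subgroups H_j with |H_j| <= 2^k: give to each j a block
   of 2^k - 1 bits with a Hamming syndrome in F_2^k, send it onto H_j, and take a fiber of
   the sum in G. It has average density 1/|G| and needs n = (number of H_j) (2^k - 1).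
   The product of the planes F^2 over the fields F of order p^D, for p running through the
   prime factors of M with multiplicity, is covered by about N = M^D subgroups of order N;
   multiplying by Z_B with B = 2^k / N rounded down gives |G| close to 2^k N, hence to n.
   With M = 2^l - 1 the numbers 2^k M^D are dense up to ratios 1 - 2^-l, and
   2^l may be taken of order ln n / ln ln n. *)

Local Open Scope ring_scope.

(** * Dominating sets of the hypercube from covers by subgroups *)

HB.instance Definition _ (A B : finZmodType) := GRing.Zmodule.on (A * B)%type.

Definition flip n (i : 'I_n) (x : {ffun 'I_n -> bool}) : {ffun 'I_n -> bool} :=
  [ffun j => (j == i) (+) x j].

Definition dominating n (D : {set {ffun 'I_n -> bool}}) : Prop :=
  forall x, x \notin D -> exists i, flip i x \in D.

Lemma fiber_le_average (X G : finType) (F : X -> G) (g0 : G) :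
  exists g, (#|[set x | F x == g]| * #|G| <= #|X|)%N.
Proof.
apply/existsP; rewrite -[X in is_true X]negbK negb_exists; apply/negP => /forallP H.
have : (\sum_(g : G) #|X| < \sum_(g : G) #|[set x | F x == g]| * #|G|)%N.
  rewrite (bigD1 g0)//= [ltnRHS](bigD1 g0)//= -addSn leq_add//.
    by rewrite ltnNge.
  by apply: leq_sum => g _; rewrite ltnW// ltnNge.
rewrite sum_nat_const -big_distrl /=.
have -> : (\sum_(g : G) #|[set x | F x == g]| = #|X|)%N.
  rewrite -[RHS]sum1_card (partition_big F xpredT)//=.
  by apply: eq_bigr => g _; rewrite -sum1_card; apply: eq_bigl => x; rewrite inE.
by rewrite mulnC ltnn.
Qed.

Lemma surjection_of_card (T X : finType) (A : {set X}) (x0 : X) :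
  x0 \in A -> (#|A| <= #|T|)%N ->
  exists f : T -> X, (forall t, f t \in A) /\ (forall x, x \in A -> exists t, f t = x).
Proof.
move=> Ax0 AT; exists (fun t => nth x0 (enum A) (enum_rank t)); split=> [t|x Ax].
  have [lt|ge] := ltnP (enum_rank t) (size (enum A)).
    by rewrite -mem_enum mem_nth.
  by rewrite nth_default.
have lt : (index x (enum A) < #|T|)%N.
  by rewrite (leq_trans _ AT)// cardE index_mem mem_enum.
exists (enum_val (Ordinal lt)).
by rewrite enum_valK /= nth_index// mem_enum.
Qed.

(** Coordinates are labelled by pairs (j, a) with a nonzero in F_2^k, and flipping one adds a to the
    j-th syndrome only. As [H j] is closed under addition, one flip can change the j-th summand by
    [g - F x] as soon as this lies in [H j]. *)
Lemma dominating_of_cover (G : finZmodType) (I : finType) (H : I -> {set G}) (k n : nat) :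
  (forall i x y, x \in H i -> y \in H i -> x + y \in H i) ->
  (forall x, exists i, x \in H i) ->
  (forall i, H i != finset.set0) ->
  (forall i, #|H i| <= 2 ^ k)%N ->
  (#|I| * (2 ^ k - 1) <= n)%N ->
  exists D : {set {ffun 'I_n -> bool}}, dominating D /\ (#|D| * #|G| <= 2 ^ n)%N.
Proof.
move=> HD Hcov Hne Hcard In.
pose T : finZmodType := 'rV['F_2]_k.
have TT (t : T) : t + t = 0.
  by apply/rowP => i; rewrite !mxE; case: (t 0 i) => [[|[|]]] // lt; apply/val_inj.
have cT : #|{: T}| = (2 ^ k)%N by rewrite card_mx mul1n card_Fp.
have [j0 _] := Hcov 0.
have /choice[phi phiP] i : exists f : T -> G, (forall t, f t \in H i) /\
    (forall x, x \in H i -> exists t, f t = x).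
  have /finset.set0Pn[x0 Hx0] := Hne i.
  by apply: (surjection_of_card Hx0); rewrite cT.
pose J := [set p : I * T | p.2 != 0].
(* Coordinates in excess get the label [(j0, 0)], which changes no syndrome. *)
pose r (i : 'I_n) := nth (j0, 0) (enum J) i.
have rP (j : I) (a : T) : a != 0 -> exists i, r i = (j, a).
  move=> a0; have Jja : (j, a) \in J by rewrite inE.
  have lt : (index (j, a) (enum J) < n)%N.
    apply: leq_trans In; rewrite -cT.
    have -> : (#|I| * (#|{: T}| - 1) = #|J|)%N.
      have -> : J = finset.setX [set: I] [set~ 0].
        by apply/finset.setP => -[u v]; rewrite !inE.
      by rewrite cardsX cardsT cardsC1 subn1.
    by rewrite cardE index_mem mem_enum.
  by exists (Ordinal lt); rewrite /r /= nth_index// mem_enum.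
pose y (j : I) (x : {ffun 'I_n -> bool}) : T :=
  \sum_(i < n) (if x i && ((r i).1 == j) then (r i).2 else 0).
have yflip i j x : y j (flip i x) = y j x + (if (r i).1 == j then (r i).2 else 0).
  rewrite /y (bigD1 i)//= [in RHS](bigD1 i)//= ffunE eqxx /=.
  rewrite [in LHS](eq_bigr (fun i => (if x i && ((r i).1 == j) then (r i).2 else 0))); last first.
    by move=> i' /negPf ne; rewrite ffunE ne.
  rewrite addrAC; congr (_ + _).
  by case: (x i); case: eqP => //= _; rewrite ?add0r ?addr0// TT.
pose F (x : {ffun 'I_n -> bool}) : G := \sum_j phi j (y j x).
have [g gP] := fiber_le_average F 0.
exists [set x | F x == g]; split; last first.
  by move: gP; rewrite card_ffun card_bool card_ord.
move=> x; rewrite inE => Fx.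
have [j gj] := Hcov (g - F x).
have [p1 p2] := phiP j.
have [t tP] := p2 _ (HD _ _ _ (p1 (y j x)) gj).
(* Otherwise [t] would be the present syndrome [y j x], forcing [F x = g]. *)
have tne : y j x + t != 0.
  apply/eqP => e; move/eqP: Fx; apply.
  have tE : t = y j x by rewrite -[t]addr0 -(TT (y j x)) addrCA [t + _]addrC e addr0.
  move: tP; rewrite tE => /(congr1 (fun z => z - phi j (y j x))).
  by rewrite subrr addrAC subrr add0r => /esym/eqP; rewrite subr_eq0 => /eqP.
have [i ri] := rP j _ tne; exists i; rewrite inE; apply/eqP.
rewrite /F (bigD1 j)//= yflip ri /= eqxx addrA TT add0r tP.
rewrite (eq_bigr (fun j => phi j (y j x))); last first.
  by move=> j' ne; rewrite yflip ri /= eq_sym (negPf ne) addr0.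
rewrite addrAC -[RHS](subrK (F x)) addrC; congr (_ + _).
by rewrite /F [in RHS](bigD1 j).
Qed.

(** * Covers of an abelian group by few subgroups *)

(** A nonempty finite set closed under addition is a subgroup. At least N subgroups of order N are
    needed for N^2 elements; the aim is L close to N. *)
Definition subgroup_cover (N L : nat) : Prop :=
  exists (A : finZmodType) (I : finType) (K : I -> {set A}),
  [/\ #|A| = (N ^ 2)%N, #|I| = L, forall i, #|K i| = N,
      forall i x y, x \in K i -> y \in K i -> x + y \in K i &
      forall x, exists i, x \in K i].

Lemma subgroup_cover1 : subgroup_cover 1 1.
Proof.
exists 'I_1, unit, (fun=> finset.setT); split=> [||_|i x y _ _|x].
- by rewrite card_ord.
- by rewrite card_unit.
- by rewrite finset.cardsT card_ord.
- by rewrite finset.in_setT.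
- by exists tt; rewrite finset.in_setT.
Qed.

Lemma subgroup_coverM N1 L1 N2 L2 :
  subgroup_cover N1 L1 -> subgroup_cover N2 L2 -> subgroup_cover (N1 * N2) (L1 * L2).
Proof.
move=> [A [I [K [cA cI cK KD Kc]]]] [B [J [K' [cB cJ cK' KD' Kc']]]].
exists (A * B)%type, (I * J)%type, (fun p => finset.setX (K p.1) (K' p.2)); split.
- by rewrite card_prod cA cB expnMn.
- by rewrite card_prod cI cJ.
- by move=> p; rewrite cardsX cK cK'.
- move=> p x y; rewrite !inE => /andP[x1 x2] /andP[y1 y2].
  by rewrite KD ?KD'.
- move=> [x y]; have [i xi] := Kc x; have [j yj] := Kc' y.
  by exists (i, j); rewrite !inE xi.
Qed.

(** The lines through the origin of the plane F^2: [Some w] has slope [w], [None] is the vertical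
    axis. *)
Lemma subgroup_cover_field (F : finFieldType) : subgroup_cover #|F| #|F|.+1.
Proof.
exists (F * F)%type, (option F),
  (fun o : option F => if o is Some w then [set (v, w * v) | v : F] else [set (0, v) | v : F]); split.
- by rewrite card_prod.
- by rewrite card_option.
- by case=> [w|]; rewrite finset.card_imset// => u v [].
- case=> [w|] x y /imsetP[u _ ->] /imsetP[v _ ->]; apply/imsetP; exists (u + v) => //.
    by rewrite mulrDr.
  by congr (_, _); rewrite addr0.
- move=> [v w]; have [->|v0] := eqVneq v 0; first by exists None; rewrite imset_f.
  exists (Some (w / v)); apply/imsetP; exists v => //.
  by rewrite divfK.
Qed.

(** M has at most l prime factors with multiplicity. Each prime p contributes the lines of a plane
    over the field of order p^D, at the cost of a factor (p^D + 1) / p^D, which is at most (2^D + 1)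
    / 2^D. *)
Lemma subgroup_cover_exp (D l M : nat) : (0 < D)%N -> (0 < M <= 2 ^ l)%N ->
  exists L, subgroup_cover (M ^ D) L /\
    (L * (2 ^ D) ^ l <= M ^ D * (2 ^ D).+1 ^ l)%N.
Proof.
move=> D0; elim: l M => [|l IH] M.
  rewrite expn0 => M1; have -> : M = 1%N by lia.
  by exists 1%N; rewrite exp1n; split=> //; exact: subgroup_cover1.
case/andP => M0; have [M1 _|M1 Ml] := leqP M 1.
  have -> : M = 1%N by lia.
  have [L [c h]] := IH 1%N (expn_gt0 2 l).
  by exists L; split=> //; rewrite !expnSr !mulnA leq_mul.
have pp := pdiv_prime M1; set p := pdiv M in pp.
have [F _ cF] := PrimePowerField pp D0.
have defM : M = (M %/ p * p)%N by rewrite divnK// pdiv_dvd.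
have p1 := prime_gt1 pp.
have [|L [c h]] := IH (M %/ p)%N.
  rewrite divn_gt0 ?prime_gt0// dvdn_leq ?pdiv_dvd//=.
  by rewrite -ltnS ltn_divLR ?prime_gt0//; rewrite expnS in Ml; nia.
exists (L * (p ^ D).+1)%N.
have -> : (M ^ D = (M %/ p) ^ D * p ^ D)%N by rewrite -expnMn -defM.
split.
  by apply: subgroup_coverM => //; rewrite -cF; exact: subgroup_cover_field.
rewrite !expnSr.
have le : ((p ^ D).+1 * 2 ^ D <= p ^ D * (2 ^ D).+1)%N.
  by rewrite mulSn mulnS leq_add2r leq_exp2r.
have := leq_mul h le.
by rewrite mulnACA [in X in (_ <= X)%N -> _]mulnACA.
Qed.

(** * Choice of the parameters *)

Local Open Scope nat_scope.

Lemma bernoulli_nat (m j : nat) : m ^ j.+1 + j.+1 * m ^ j <= m.+1 ^ j.+1.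
Proof.
elim: j => [|j IH]; first by rewrite !expn1 expn0; lia.
rewrite [in leqRHS]expnS; apply: leq_trans (leq_mul (leqnn m.+1) IH).
by rewrite !expnS; set x := m ^ j; nia.
Qed.

(** For m + 1 = 2^l: lowering a product 2^l times by the ratio m / (m + 1) at least halves it. *)
Lemma double_power_le (m : nat) : 2 * m ^ m.+1 <= m.+1 ^ m.+1.
Proof.
apply: leq_trans (bernoulli_nat m m); rewrite mul2n -addnn leq_add2l.
by rewrite expnS leq_mul.
Qed.

Lemma double_le_exp2 l : 2 * l <= 2 ^ l.
Proof. by elim: l => [|[|l] IH] //; rewrite expnS; lia. Qed.

(* Trading l factors 2 for one factor 2^l - 1 lowers a product by the ratio 1 - 2^-l, so
   the products of powers of 2 and 2^l - 1 below n come within this ratio of n. *)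
Lemma fine_power_below (n l : nat) : 2 <= l -> 2 ^ (6 * l * 2 ^ l) <= n ->
  exists E q, [/\ 2 * l <= E, (2 ^ l).-1 ^ E * 2 ^ q <= n,
    n * (2 ^ l).-1 < (2 ^ l).-1 ^ E * 2 ^ q * 2 ^ l, l <= q &
    2 ^ l * (2 ^ l).-1 ^ E.+1 <= 2 ^ (q - l)].
Proof.
move=> l2 ln; have dl := double_le_exp2 l.
have [m defP] : exists m, 2 ^ l = m.+1 by exists (2 ^ l).-1; rewrite prednK// expn_gt0.
have m3 : 3 <= m by rewrite -ltnS -defP (leq_trans _ (_ : 2 ^ 2 <= _))// leq_exp2l.
have mM e : m ^ e <= 2 ^ (l * e).
  by case: e => [|e]; rewrite ?muln0// expnM leq_exp2r ?defP.
rewrite defP /=.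
have [K0 K0P] : exists K, n < m ^ (2 * l) * 2 ^ K.
  exists n; apply: leq_trans (ltn_expl n (ltnSn 1)) _.
  by rewrite leq_pmull// expn_gt0; lia.
(* Minimality of [K] puts [m ^ (2 * l) * 2 ^ K] between n and 2n. The factor [m ^ (2 * l)] secures
   [2 * l <= E]. *)
have [K nK Kmin] := ex_minnP (ex_intro (fun K => n < m ^ (2 * l) * 2 ^ K) K0 K0P).
have le1 : 6 * l * 2 ^ l < l * (2 * l) + K.
  rewrite -(@ltn_exp2l 2)// expnD; apply: leq_ltn_trans ln _.
  by apply: leq_trans nK _; rewrite leq_mul2r mM orbT.
have nK2 : m ^ (2 * l) * 2 ^ K <= 2 * n.
  case: K Kmin le1 {nK} => [|K] Kmin le1; first by nia.
  rewrite leqNgt; apply/negP => h.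
  have : n < m ^ (2 * l) * 2 ^ K by move: h; rewrite expnS; lia.
  by move=> /Kmin; rewrite ltnn.
(* The product after [t] exchanges. The first [t] with [g t <= n] is taken; [2 ^ l] exchanges
   suffice by [double_power_le]. *)
pose g t := m ^ (2 * l + t) * 2 ^ (K - l * t).
have lK : l * 2 ^ l <= K by nia.
have gS t : t < 2 ^ l -> g t.+1 * 2 ^ l = g t * m.
  move=> tP; rewrite /g.
  have -> : K - l * t = K - l * t.+1 + l by nia.
  by rewrite addnS expnS (expnD 2); ring.
have gE t : t <= 2 ^ l -> g t * (2 ^ l) ^ t = g 0 * m ^ t.
  elim: t => [//|t IH tP].
  by rewrite !expnS mulnA gS// [m * _]mulnC mulnA -IH 1?ltnW//; lia.
have gP : g (2 ^ l) <= n.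
  rewrite -(@leq_pmul2r ((2 ^ l) ^ (2 ^ l))) ; last by rewrite !expn_gt0.
  rewrite gE// defP.
  apply: leq_trans (_ : n * (2 * m ^ m.+1) <= _); last first.
    by rewrite leq_mul2l double_power_le orbT.
  rewrite mulnA [n * 2]mulnC leq_mul2r; apply/orP; right.
  by rewrite /g muln0 subn0 addn0.
have [t gt tmin] := ex_minnP (ex_intro (fun t => g t <= n) _ gP).
have tP := tmin _ gP.
case: t gt tmin tP => [|t] gt tmin tP.
  by move: gt; rewrite /g muln0 subn0 addn0 leqNgt nK.
have gt' : n < g t by rewrite ltnNge; apply/negP => /tmin; rewrite ltnn.
(* The large lower bound on [n] leaves this exponent of 2 after at most [2 ^ l] exchanges of [l]
   factors each. *)
have lq : 2 * l + l * (2 * l + 2 ^ l + 1) <= K - l * t.+1.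
  by clear -tP le1 dl l2; nia.
exists (2 * l + t.+1), (K - l * t.+1); split => //.
- by rewrite leq_addr.
- by rewrite -/(g t.+1) -defP gS// ltn_pmul2r; lia.
- by lia.
- apply: leq_trans (leq_mul (leqnn m.+1) (mM _)) _.
  by rewrite -defP -expnD leq_exp2l//; clear -tP lq; nia.
Qed.

(** * Thin dominating sets of the hypercube *)

(** Here M = 2^l - 1, k = q - l and |G| = B N^2 with N = M^(E+1). The ratio M / 2^l is lost three
    times: in approximating n, in the number L of subgroups, and in rounding B. *)
Lemma hypercube_dominating (n l : nat) : 2 <= l -> 2 ^ (6 * l * 2 ^ l) <= n ->
  exists D : {set {ffun 'I_n -> bool}},
    dominating D /\ #|D| * n * (2 ^ l).-1 ^ 3 <= 2 ^ n * (2 ^ l) ^ 3.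
Proof.
move=> l2 /(fine_power_below l2)[E [q [lE En nE lq Ek]]].
have P2 : 1 < 2 ^ l by rewrite -{1}(expn0 2) ltn_exp2l; lia.
have P1 : 0 < 2 ^ l by lia.
have dl := double_le_exp2 l.
have [|L [[A [I [K [cA cI cK KD Kc]]]] LP]] := @subgroup_cover_exp E.+1 l (2 ^ l).-1 isT.
  by apply/andP; split; lia.
set P := 2 ^ l in P1 P2 dl En nE LP Ek cA cK *; set M := P.-1 in En nE LP Ek cA cK *.
have MP : M.+1 = P by rewrite /M; lia.
have M0 : 0 < M by lia.
set N := M ^ E.+1 in cA cK LP Ek.
have N0 : 0 < N by rewrite expn_gt0 M0.
(* With T = 2^(E+1), the factor (1 + 1/T)^l is at most T / (T - l), and P l <= T bounds this by P /
   M. *)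
have LM : L * M <= N * P.
  set T := 2 ^ E.+1 in LP.
  have PT : P * l <= T.
    apply: (leq_trans (_ : _ <= P * P)); first by rewrite leq_mul2l; apply/orP; right; lia.
    by rewrite -expnD leq_exp2l; lia.
  have aux j : j <= l -> T.+1 ^ j * (T - j) <= T ^ j * T.
    elim: j => [|j IH] jl; first by rewrite !expn0 subn0.
    have jT : j < T by nia.
    apply: leq_trans (_ : T.+1 ^ j * (T * (T - j)) <= _).
      by rewrite expnS mulnAC mulnC leq_mul2l; apply/orP; right; nia.
    by rewrite mulnCA expnS -mulnA leq_mul2l IH ?orbT// ltnW.
  have lT : l <= T by nia.
  have h1 : T.+1 ^ l * M <= T ^ l * P.
    rewrite -(@leq_pmul2r T) ?expn_gt0//.
    apply: leq_trans (_ : T.+1 ^ l * (T - l) * P <= _).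
      by rewrite -!mulnA leq_mul2l; apply/orP; right; nia.
    by rewrite [leqRHS]mulnAC leq_mul2r aux// orbT.
  rewrite -(@leq_pmul2r (T ^ l)) ?expn_gt0//.
  rewrite mulnAC; apply: leq_trans (leq_mul LP (leqnn M)) _.
  by rewrite -!mulnA leq_mul2l [P * _]mulnC h1 orbT.
have k0 : N <= 2 ^ (q - l) by apply: leq_trans Ek; rewrite leq_pmull.
pose B := 2 ^ (q - l) %/ N.
have B0 : 0 < B by rewrite divn_gt0.
(* The group is the product of Z_B and [A]; the subgroups have order B N <= 2^k. *)
pose H (i : I) := finset.setX (finset.setT : {set 'I_B.-1.+1}) (K i).
have [| | | | |D [Ddom Dcard]] := @dominating_of_cover _ I H (q - l) n.
- by move=> i x y; rewrite !inE /=; exact: KD.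
- by move=> x; have [i xi] := Kc x.2; exists i; rewrite !inE.
- by move=> i; rewrite -card_gt0 cardsX finset.cardsT card_ord cK; lia.
- by move=> i; rewrite cardsX finset.cardsT card_ord cK prednK// leq_trunc_div.
- have LE : L <= M ^ E * P.
    by rewrite -(@leq_pmul2r M)// (leq_trans LM)// /N expnSr -!mulnA [M * _]mulnC.
  apply: leq_trans En; rewrite cI.
  apply: leq_trans (leq_mul LE (leq_subr 1 _)) _.
  by rewrite -mulnA -expnD subnKC.
exists D; split=> //.
have cG : #|{: 'I_B.-1.+1 * A}| = B * N ^ 2 by rewrite card_prod card_ord cA prednK.
rewrite cG in Dcard.
have key : n * M ^ 3 <= B * N ^ 2 * P ^ 3.
  have qE : 2 ^ q = 2 ^ (q - l) * P by rewrite -expnD subnK.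
  (* Rounding loses less than N, and [Ek] bounds N by 2^(q-l) / P. *)
  have BN : 2 ^ (q - l) * M <= B * N * P.
    have := ltn_ceil (2 ^ (q - l)) N0; rewrite -/B mulSn => h.
    have : 2 ^ (q - l) * P <= (N + B * N) * P by rewrite leq_mul2r ltnW ?orbT.
    by rewrite -MP mulnS mulnDl MP; lia.
  apply: leq_trans (_ : M ^ E * 2 ^ q * P * M ^ 2 <= _).
    by rewrite (expnSr M 2) [M ^ 2 * M]mulnC mulnA leq_mul2r (ltnW nE) orbT.
  have -> : M ^ E * 2 ^ q * P * M ^ 2 = (2 ^ (q - l) * M) * (N * P ^ 2).
    by rewrite qE /N (expnS M E); ring.
  have -> : B * N ^ 2 * P ^ 3 = (B * N * P) * (N * P ^ 2) by ring.
  by rewrite leq_mul2r BN orbT.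
rewrite -mulnA; apply: leq_trans (leq_mul (leqnn #|D|) key) _.
by rewrite mulnA leq_mul2r Dcard orbT.
Qed.

(** * Unit balls of the lattice *)

Local Open Scope classical_set_scope.
Local Open Scope ring_scope.

Definition l1dist n (x y : {ffun 'I_n -> int}) : nat := (\sum_(i < n) `|x i - y i|)%N.

Lemma lattice_edgeE n (x y : {ffun 'I_n -> int}) :
  lattice_edge x y = (l1dist x y == 1%N).
Proof.
rewrite /lattice_edge /l1dist -eqz_nat -[X in _ = (X == _)]natz natr_sum.
by under [in RHS]eq_bigr do rewrite natz abszE.
Qed.

Lemma l1distC n (x y : {ffun 'I_n -> int}) : l1dist x y = l1dist y x.
Proof. by apply: eq_bigr => i _; lia. Qed.

Lemma l1distxx n (x : {ffun 'I_n -> int}) : l1dist x x = 0%N.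
Proof. by rewrite /l1dist big1// => i _; rewrite subrr. Qed.

Lemma l1dist_eq0 n (x y : {ffun 'I_n -> int}) : l1dist x y = 0%N -> x = y.
Proof.
move=> /eqP; rewrite sum_nat_eq0 => /forallP h; apply/ffunP => i.
by have := h i => /=; lia.
Qed.

Lemma gball1E n (v u : lattice n) : gball 1 v u <-> (l1dist u v <= 1)%N.
Proof.
rewrite /gball /= /gdist; case: ex_minnP => k /asboolP[p [pp lp sp]] kmin; split=> [k1|le].
  move: pp lp sp; case: p => [|w [|]]; last by move=> ? ? _ _ /= ?; lia.
    by move=> _ /= -> _; rewrite l1distxx.
  by rewrite /= andbT lattice_edgeE => /eqP e <- _; rewrite e.
have [d0|d1] : l1dist u v = 0%N \/ l1dist u v = 1%N by lia.
  apply: leq_trans (kmin 0%N _) _ => //; apply/asboolP; exists [::]; split=> //=.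
  exact: l1dist_eq0.
apply: kmin; apply/asboolP; exists [:: v]; split=> //=.
by rewrite lattice_edgeE d1.
Qed.

Definition shift1 n (i : 'I_n) (s : bool) (x : {ffun 'I_n -> int}) : {ffun 'I_n -> int} :=
  [ffun j => if j == i then (if s then x j + 1 else x j - 1) else x j].

Lemma l1dist_shift1 n (i : 'I_n) s (x : {ffun 'I_n -> int}) : l1dist (shift1 i s x) x = 1%N.
Proof.
rewrite /l1dist (bigD1 i)//= big1 => [|j /negPf ji]; rewrite !ffunE ?eqxx ?ji ?subrr//.
by case: s; lia.
Qed.

Lemma l1dist_le1 n (x y : {ffun 'I_n -> int}) : (l1dist x y <= 1)%N ->
  x = y \/ exists i s, x = shift1 i s y.
Proof.
move=> le; have [->|/eqP ne] := eqVneq x y; first by left.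
right; have [i xyi] : exists i, x i != y i.
  apply/existsP; rewrite -negb_forall; apply/negP => /forallP h.
  by apply: ne; apply/ffunP => i; apply/eqP.
move: le; rewrite /l1dist (bigD1 i)//=; set S := (\sum_(j < n | _) _)%N => le.
have /eqP : S = 0%N by lia.
rewrite sum_nat_eq0 => /forallP h.
exists i, (y i < x i); apply/ffunP => j; rewrite ffunE; case: eqVneq => [->|ji].
  by clear h; move: (x i) (y i) S xyi le => a b S; case: ifP; lia.
by have := h j; rewrite ji /=; lia.
Qed.

Lemma l1dist_ge1 n (i : 'I_n) (x y : {ffun 'I_n -> int}) :
  (`|x i - y i| <= l1dist x y)%N.
Proof. by rewrite /l1dist (bigD1 i)//= leq_addr. Qed.

Lemma l1dist_ge2 n (i j : 'I_n) (x y : {ffun 'I_n -> int}) : j != i ->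
  (`|x i - y i| + `|x j - y j| <= l1dist x y)%N.
Proof.
by move=> ji; rewrite /l1dist (bigD1 i)//= (bigD1 j)//= addnA leq_addr.
Qed.

(** Being within 1 of both v_i + 1 and v_i - 1, the coordinate u_i equals v_i. This uses up the
    distance, so all other coordinates agree. *)
Lemma straight_pair n (i : 'I_n) (u v : {ffun 'I_n -> int}) :
  (l1dist (shift1 i true v) u <= 1)%N -> (l1dist (shift1 i false v) u <= 1)%N -> u = v.
Proof.
move=> h1 h2; apply/ffunP => j; have [->|ji] := eqVneq j i.
  have := leq_trans (l1dist_ge1 i _ _) h1; have := leq_trans (l1dist_ge1 i _ _) h2.
  by rewrite !ffunE eqxx; move: (u i) (v i) => a b; lia.
have := leq_trans (l1dist_ge2 _ _ ji) h1; have := leq_trans (l1dist_ge2 _ _ ji) h2.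
by rewrite !ffunE eqxx (negPf ji); move: (u i) (v i) (u j) (v j) => a b c d; lia.
Qed.

(** * Identifying codes defined by parities *)

Definition parity n (x : {ffun 'I_n -> int}) : {ffun 'I_n -> bool} :=
  [ffun i => odd `|x i|%N].

Lemma parity_shift1 n (i : 'I_n) s x : parity (shift1 i s x) = flip i (parity x).
Proof.
apply/ffunP => j; rewrite !ffunE; case: eqVneq => [->|//].
by case: s; lia.
Qed.

Definition parity_code n (D : {set {ffun 'I_n -> bool}}) : set (lattice n) :=
  [set x : {ffun 'I_n -> int} | parity x \in D].

(* Membership in the code depends only on parities, so one codeword v + e_i next to v comes
   with v - e_i, and no other vertex is adjacent to both. *)
Lemma identifying_parity_code n (D : {set {ffun 'I_n -> bool}}) :
  dominating D -> identifying 1 (parity_code D).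
Proof.
move=> Ddom.
have cov (v : lattice n) : gball 1 v `&` parity_code D !=set0.
  have [vD|/Ddom[i iD]] := boolP (parity v \in D).
    by exists v; split=> //; apply/gball1E; rewrite l1distxx.
  exists (shift1 i true v); split; first by apply/gball1E; rewrite l1dist_shift1.
  by rewrite /parity_code /= parity_shift1.
split=> //; first by have [x [_ xC]] := cov [ffun=> 0]; exists x.
have pair (u v : lattice n) i : gball 1 u `&` parity_code D = gball 1 v `&` parity_code D ->
    flip i (parity v) \in D -> u = v.
  move=> eqI iD.
  have near s : (l1dist (shift1 i s v) u <= 1)%N.
    suff : (gball 1 v `&` parity_code D) (shift1 i s v).
      by rewrite -eqI => -[/gball1E].
    split; first by apply/gball1E; rewrite l1dist_shift1.
    by rewrite /parity_code /= parity_shift1.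
  exact: straight_pair (near true) (near false).
move=> u v uv eqI; apply: uv.
have [vD|/Ddom[i iD]] := boolP (parity v \in D); last exact: pair iD.
(* A codeword [v] lies in the ball of [u] too, hence is a neighbour of [u] if distinct from it, and
   [pair] applies with the two vertices exchanged. *)
have : (gball 1 v `&` parity_code D) v.
  by split=> //; apply/gball1E; rewrite l1distxx.
rewrite -eqI => -[/gball1E /l1dist_le1[//|[i [s vE]]] _].
apply/esym/(pair v u i) => //.
by rewrite -(parity_shift1 _ s) -vE.
Qed.

(** * Counting in cubes *)

Lemma card_cube n m : #|` fset_set (cube n m)| = (m.*2.+1 ^ n)%N.
Proof.
pose f (t : {ffun 'I_n -> 'I_(m.*2.+1)}) : lattice n := [ffun i => (t i)%:Z - m%:Z].
have f_inj : injective f.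
  move=> s t /ffunP e; apply/ffunP => i; apply/val_inj => /=.
  by have := e i; rewrite !ffunE => /addIr [].
have -> : cube n m = f @` setT.
  apply/seteqP; split=> [x xm|_ [t _ <-] i]; last first.
    rewrite ffunE; have := ltn_ord (t i); move: (nat_of_ord (t i)) => k; lia.
  exists [ffun i => inord (absz ((x : {ffun 'I_n -> int}) i + m%:Z))] => //.
  apply/ffunP => i; rewrite !ffunE; have := xm i.
  by move: ((x : {ffun 'I_n -> int}) i) => z h; rewrite inordK; lia.
rewrite fset_set_image; last exact: finite_finset.
rewrite card_imfset//= (perm_size (_ : perm_eq _ (enum {: {ffun 'I_n -> 'I_(m.*2.+1)}}))).
  by rewrite -cardE card_ffun !card_ord.
apply: uniq_perm; rewrite ?fset_uniq ?enum_uniq// => t.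
by rewrite in_fset_set ?mem_enum ?in_setT//; exact: finite_finset.
Qed.

Lemma uniq_leq_map (T U : eqType) (s : seq T) (t : seq U) (f : T -> U) :
  uniq s -> {in s &, injective f} -> {in s, forall x, f x \in t} -> (size s <= size t)%N.
Proof.
move=> us inj st; rewrite -(size_map f); apply: uniq_leq_size.
  by rewrite map_inj_in_uniq.
by move=> _ /mapP[x /st xt ->].
Qed.

(** Halving x_i + m is injective on the integers of a given parity in [-m, m], with values at most
    m. *)
Lemma card_parity_code_cube n m (D : {set {ffun 'I_n -> bool}}) :
  (#|` fset_set (parity_code D `&` cube n m)| <= #|D| * m.+1 ^ n)%N.
Proof.
pose f (x : lattice n) : {ffun 'I_n -> bool} * {ffun 'I_n -> 'I_m.+1} :=
  (parity x, [ffun i => inord (absz ((x : {ffun 'I_n -> int}) i + m%:Z))./2]).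
have fin : finite_set (parity_code D `&` cube n m).
  by apply: sub_finite_set (@finite_cube n m) => x [].
have -> : (#|D| * m.+1 ^ n)%N = size (enum (finset.setX D [set: {ffun 'I_n -> 'I_m.+1}]%SET)).
  by rewrite -cardE cardsX finset.cardsT card_ffun !card_ord.
apply: (@uniq_leq_map _ _ _ _ f); first exact: fset_uniq.
- move=> x y; rewrite !in_fset_set// => /set_mem[_ xm] /set_mem[_ ym] [/ffunP p /ffunP q].
  apply/ffunP => i; have := p i; have := q i; rewrite !ffunE => /(congr1 val) /=.
  have := xm i; have := ym i.
  move: ((x : {ffun _ -> _}) i) ((y : {ffun _ -> _}) i) => a b am bm.
  by rewrite /= !inordK; lia.
- move=> x; rewrite in_fset_set// => /set_mem[xD _].
  by rewrite mem_enum !inE /= andbT.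
Qed.

Lemma ball_count n (s : seq {ffun 'I_n -> int}) (c : {ffun 'I_n -> int}) : uniq s ->
  (count (fun v => l1dist c v <= 1)%N s <= n.*2.+1)%N.
Proof.
move=> us; rewrite -size_filter.
pose nb (o : option ('I_n * bool)) := if o is Some (i, b) then shift1 i b c else c.
have -> : n.*2.+1 = size (map nb (enum {: option ('I_n * bool)})).
  by rewrite size_map -cardE card_option card_prod card_ord card_bool muln2.
apply: uniq_leq_size; first exact: filter_uniq.
move=> v; rewrite mem_filter l1distC => /andP[/l1dist_le1[->|[i [b ->]]] _].
  by apply/mapP; exists None => //; rewrite mem_enum.
by apply/mapP; exists (Some (i, b)) => //; rewrite mem_enum.
Qed.

(** Codewords within distance 1 of the cube lie in the next cube, so [I v] is the whole identifying
    set of [v]. The sizes of the [I v] sum to at most |A| (2n + 1), and to at least 2|Q| minus the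
    number of singletons, which is at most |A|. *)
Lemma identifying_cube_count n m (C : set (lattice n)) : identifying 1 C ->
  (2 * #|` fset_set (cube n m)| <= #|` fset_set (C `&` cube n m.+1)| * (n.*2.+2))%N.
Proof.
move=> [_ Cne Cdist].
have finA : finite_set (C `&` cube n m.+1).
  by apply: sub_finite_set (@finite_cube n m.+1) => x [].
set Q := fset_set _; set A := fset_set _.
pose I (v : lattice n) : seq (lattice n) := [seq c <- enum_fset A | (l1dist c v <= 1)%N].
have IE v : v \in Q -> gball 1 v `&` C = [set c | c \in I v].
  rewrite in_fset_set; last exact: finite_cube.
  move=> /set_mem vQ; apply/seteqP; split=> c /=.
    move=> [/gball1E cv Cc]; rewrite mem_filter cv /= in_fset_set//; apply/mem_set; split=> // i.
    have := vQ i; have := leq_trans (l1dist_ge1 i _ _) cv.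
    by move: ((c : {ffun _ -> _}) i) ((v : {ffun _ -> _}) i) => a b; lia.
  by rewrite mem_filter in_fset_set// => /andP[/gball1E cv /set_mem[Cc _]].
have I0 v : v \in Q -> (0 < size (I v))%N.
  move=> vQ; have [c] := Cne v; rewrite IE//= => cI.
  by case: (I v) cI.
have Iinj : {in Q &, injective I}.
  move=> u v uQ vQ e; apply: contrapT => uv; apply: (Cdist _ _ uv).
  by rewrite !IE// e.
have single : (count (fun v => size (I v) == 1%N) (enum_fset Q) <= #|` A|)%N.
  rewrite -size_filter; apply: (@uniq_leq_map _ _ _ _ (fun v => head v (I v))).
  - exact/filter_uniq/fset_uniq.
  - move=> u v; rewrite !mem_filter => /andP[u1 uQ] /andP[v1 vQ] huv.
    apply: Iinj => //; move: u1 v1 huv.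
    by case: (I u) => [|a [|]]//; case: (I v) => [|b [|]]//= _ _ ->.
  - move=> v; rewrite mem_filter => /andP[v1 vQ].
    have : head v (I v) \in I v by case: (I v) v1 => //= a s _; rewrite mem_head.
    by rewrite mem_filter => /andP[].
have double : (\sum_(v <- enum_fset Q) size (I v) <= #|` A| * n.*2.+1)%N.
  have constS (s : seq (lattice n)) k : (size s * k = \sum_(c <- s) k)%N.
    by rewrite big_const_seq count_predT iter_addn_0 mulnC.
  under eq_bigr do rewrite size_filter -sum1_count big_mkcond /=.
  rewrite exchange_big /= constS.
  apply: leq_sum => c _; rewrite -big_mkcond sum1_count.
  exact/ball_count/fset_uniq.
have : (\sum_(v <- enum_fset Q) 2 <=
        \sum_(v <- enum_fset Q) size (I v) + count (fun v => size (I v) == 1%N) (enum_fset Q))%N.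
  rewrite -sum1_count [X in (_ + X)%N]big_mkcond -big_split /=.
  rewrite big_seq [leqRHS]big_seq; apply: leq_sum => v /I0.
  by case: (size (I v)) => [|[|]].
rewrite big_const_seq count_predT iter_addn_0.
move=> /leq_trans; apply; rewrite [leqRHS]mulnS [leqRHS]addnC.
exact: leq_add.
Qed.

(** * Bounds on densities *)

(** The shift serves counts that compare the cube of radius m with that of radius m + 1; the tail
    from m contains the term of index m + 1. *)
Lemma le_limn_esup_shift (R : realType) (u : (\bar R)^nat) (l : R^nat) (c : R) :
  (forall m, (l m)%:E <= u m.+1)%E -> l @ \oo --> c -> (c%:E <= limn_esup u)%E.
Proof.
move=> lu lc; rewrite limn_esup_lim.
have lcE : EFin \o l @ \oo --> c%:E by apply: cvg_EFin => //; exact: nearW.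
rewrite -(cvg_lim _ lcE)//; apply: lee_lim; first by exact: (cvgP _ lcE).
  exact: is_cvg_esups.
apply: nearW => m /=; apply: le_trans (lu m) _; apply: ereal_sup_ubound.
by exists m.+1 => //=; exact: leqnSn.
Qed.

Lemma limn_esup_le (R : realType) (u : (\bar R)^nat) (l : R^nat) (c : R) :
  (forall m, u m <= (l m)%:E)%E -> l @ \oo --> c -> (limn_esup u <= c%:E)%E.
Proof.
move=> lu lc.
have lcE : EFin \o l @ \oo --> c%:E by apply: cvg_EFin => //; exact: nearW.
rewrite -(cvg_lim _ lcE)// -is_cvg_limn_esupE; last by exact: (cvgP _ lcE).
rewrite !limn_esup_lim; apply: lee_lim; [exact: is_cvg_esups|exact: is_cvg_esups|].
apply: nearW => m; apply: ge_ereal_sup => _ [k mk <-].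
by apply: le_trans (lu k) _; apply: ereal_sup_ubound; exists k.
Qed.

Lemma density_ge (R : realType) n (C : set (lattice n)) : identifying 1 C ->
  ((1 / (n%:R + 1))%:E <= density R C)%E.
Proof.
(* [harmonic m] is 1/(m+1), and 1 - 1/(m+1) is at most (2m+1)/(2m+3), the ratio of the sides of
   consecutive cubes. *)
move=> iC; pose l (m : nat) : R := 1 / (n%:R + 1) * (1 - harmonic m) ^+ n.
apply: (@le_limn_esup_shift _ _ l) => [m|].
  rewrite lee_fin /l !card_cube.
  have n0 : 0 < (n%:R + 1 : R) by rewrite ltr_wpDl.
  have := identifying_cube_count m iC; set A := #|` fset_set (C `&` _)|; rewrite card_cube => h.
  have p0 : 0 < ((m.+1.*2.+1 ^ n)%:R : R) by rewrite ltr0n expn_gt0.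
  rewrite ler_pdivlMr// div1r -mulrA mulrC ler_pdivrMr//.
  have {}h : (m.*2.+1%:R : R) ^+ n <= A%:R * (n%:R + 1).
    rewrite -(@ler_pM2l _ 2)//.
    have : ((2 * m.*2.+1 ^ n)%:R : R) <= (A * n.*2.+2)%:R by rewrite ler_nat.
    have -> : n.*2.+2 = (n.+1 * 2)%N by rewrite muln2.
    by rewrite !natrM natrX -natr1; lra.
  apply: le_trans h; rewrite natrX -exprMn.
  have m0 : 0 < (m%:R + 1 : R) by rewrite ltr_wpDl.
  have hE : 0 <= (1 - harmonic m) * (m.+1.*2.+1)%:R :> R /\ (1 - harmonic m) * (m.+1.*2.+1)%:R <= (m.*2.+1%:R : R).
    have -> : (m.+1.*2.+1%:R : R) = 2 * m%:R + 3 by rewrite -muln2 -addn1 natrD natrM -natr1; lra.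
    have -> : (m.*2.+1%:R : R) = 2 * m%:R + 1 by rewrite -muln2 -addn1 natrD natrM; lra.
    have -> : harmonic m = (m%:R + 1 : R)^-1 by rewrite /= -natr1.
    have -> : 1 - (m%:R + 1)^-1 = m%:R / (m%:R + 1) :> R by field; rewrite gt_eqF.
    have x0 : 0 <= (m%:R : R) by [].
    split; first by rewrite mulr_ge0 ?divr_ge0//; lra.
    by rewrite mulrAC ler_pdivrMr//; nra.
  by case: hE => hE0 hE1; apply: lerXn2r; rewrite ?nnegrE// (le_trans hE0).
have -> : 1 / (n%:R + 1) = 1 / (n%:R + 1) * (1 - 0) ^+ n :> R.
  by rewrite subr0 expr1n mulr1.
apply: cvgMr; apply: (@cvg_comp _ _ _ _ (fun x : R => x ^+ n)); last exact: exprn_continuous.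
apply: cvgB; [exact: cvg_cst|exact: cvg_harmonic].
Qed.

Lemma density_parity_code_le (R : realType) n (D : {set {ffun 'I_n -> bool}}) :
  (density R (parity_code D) <= (#|D|%:R / 2 ^+ n)%:E)%E.
Proof.
(* The count gives the ratio (m+1)/(2m+1), at most 1/2 + 1/(m+1), in each dimension. *)
pose l (m : nat) : R := #|D|%:R * (2^-1 + harmonic m) ^+ n.
apply: (@limn_esup_le _ _ l) => [m|].
  rewrite lee_fin /l card_cube.
  have p0 : 0 < ((m.*2.+1 ^ n)%:R : R) by rewrite ltr0n expn_gt0.
  rewrite ler_pdivrMr//.
  apply: (@le_trans _ _ (#|D| * m.+1 ^ n)%:R); first by rewrite ler_nat card_parity_code_cube.
  rewrite natrM -mulrA ler_wpM2l// !natrX -exprMn.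
  have hE : (m.+1%:R : R) <= (2^-1 + harmonic m) * m.*2.+1%:R.
    have -> : (m.*2.+1%:R : R) = 2 * m%:R + 1 by rewrite -muln2 -addn1 natrD natrM; lra.
    have x0 : 0 <= (m%:R : R) by [].
    have : 1 <= (2 * m%:R + 1 : R) / (m%:R + 1) by rewrite ler_pdivlMr; lra.
    have -> : harmonic m = (m%:R + 1 : R)^-1 by rewrite /= -natr1.
    by rewrite -[m.+1%:R]natr1 [(_ + (m%:R + 1)^-1) * _]mulrDl [(m%:R + 1)^-1 * _]mulrC; lra.
  by apply: lerXn2r; rewrite ?nnegrE// (le_trans _ hE).
have -> : #|D|%:R / 2 ^+ n = #|D|%:R * (2^-1 + 0) ^+ n :> R by rewrite addr0 exprVn.
apply: cvgMr; apply: (@cvg_comp _ _ _ _ (fun x : R => x ^+ n)); last exact: exprn_continuous.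
apply: cvgD; [exact: cvg_cst|exact: cvg_harmonic].
Qed.

(** * Asymptotics in the dimension *)

Lemma scale_of_dimension : exists N0, forall n, (N0 <= n)%N -> exists l,
  [/\ (2 <= l)%N, (2 ^ (6 * l * 2 ^ l) <= n)%N & (n < 2 ^ (6 * l.+1 * 2 ^ l.+1))%N].
Proof.
(* The threshold is the case l = 2; the largest admissible l is then taken. *)
exists (2 ^ (6 * 2 * 2 ^ 2))%N => n Nn.
pose p l := (2 ^ (6 * l * 2 ^ l) <= n)%N.
have pn l : p l -> (l <= n)%N.
  move=> /(leq_trans _); apply; apply: ltnW; apply: leq_trans (ltn_expl l (ltnSn 1)) _.
  by rewrite leq_exp2l//; have := expn_gt0 2 l; nia.
have [l pl lmax] := ex_maxnP (ex_intro p _ Nn) pn.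
exists l; split=> //; first exact: lmax.
by rewrite ltnNge; apply/negP => /lmax; rewrite ltnn.
Qed.

(** The upper bound on n gives ln n <= 12 (l + 1) 2^l ln 2 <= 24 l 2^l ln 2; the lower one gives ln
    n >= 2^l, hence ln ln n >= l ln 2. *)
Lemma lnln_over_ln_ge (R : realType) (n l : nat) : (2 <= l)%N ->
  (2 ^ (6 * l * 2 ^ l) <= n)%N -> (n < 2 ^ (6 * l.+1 * 2 ^ l.+1))%N ->
  (24 * 2 ^+ l)^-1 <= ln (ln n%:R) / ln n%:R :> R.
Proof.
move=> l2 ln_ nl.
have P0 : 0 < 2 ^+ l :> R by rewrite exprn_gt0.
have ln2 : 2^-1 <= ln 2 :> R.
  have : ln (1 + (- 2^-1)) <= - 2^-1 :> R by apply: le_ln1Dx; lra.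
  have -> : 1 + (- 2^-1) = 2^-1 :> R by lra.
  by rewrite lnV ?posrE//; lra.
have lnexp k : ln (2 ^ k)%:R = k%:R * ln 2 :> R by rewrite natrX lnXn// mulr_natl.
have n0 : (0 < n)%N by apply: leq_trans ln_; rewrite expn_gt0.
have l2R : 2 <= l%:R :> R by rewrite (ler_nat R 2).
have up : ln n%:R <= 24 * 2 ^+ l * (l%:R * ln 2) :> R.
  apply: (@le_trans _ _ (ln (2 ^ (6 * l.+1 * 2 ^ l.+1))%:R)).
    by rewrite ler_ln ?posrE ?ltr0n ?expn_gt0// ler_nat ltnW.
  rewrite lnexp !natrM natrX exprS -natr1.
  have : l%:R + 1 <= 2 * l%:R :> R by lra.
  have : 0 < 2 ^+ l * ln 2 :> R by rewrite mulr_gt0//; lra.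
  by nra.
have low : 2 ^+ l <= ln n%:R :> R.
  apply: (@le_trans _ _ (ln (2 ^ (6 * l * 2 ^ l))%:R)); last first.
    by rewrite ler_ln ?posrE ?ltr0n ?expn_gt0// ler_nat.
  rewrite lnexp !natrM natrX.
  have : 1 <= l%:R * ln 2 :> R by nra.
  by nra.
have L0 : 0 < ln n%:R :> R by apply: lt_le_trans low.
have low2 : l%:R * ln 2 <= ln (ln n%:R) :> R.
  by rewrite mulr_natl -lnXn// ler_ln ?posrE.
rewrite ler_pdivlMr// mulrC ler_pdivrMr ?mulr_gt0//.
apply: le_trans up _; rewrite mulrC ler_wpM2r// mulr_ge0//.
Qed.

(** For x = n and t = 2^-l. Replacing 1/x by 1/(x+1) costs a factor 1 + t, and (1 - t)^3 >= 1 - 3t;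
    since t <= 1/4, the generous constant 80 absorbs the quadratic term. *)
Lemma density_slack (R : realType) (x t : R) : 0 < t -> 4 * t <= 1 -> 1 <= x * t ->
  (1 - t) ^- 3 / x <= (1 + 80 * t) * (1 / (x + 1)).
Proof.
move=> t0 t4 xt.
have x0 : 0 < x by nra.
have q0 : 0 < 1 - t by lra.
have p1 : 0 < (1 - t) ^+ 3 by rewrite exprn_gt0.
rewrite mulrC -invfM mul1r -[leRHS]/((1 + 80 * t) / (x + 1)).
have x1 : 0 < x + 1 by lra.
rewrite ler_pdivlMr// mulrC ler_pdivrMr ?mulr_gt0//.
have h1 : x + 1 <= x * (1 + t) by nra.
have h2 : 1 + t <= (1 + 80 * t) * (1 - t) ^+ 3.
  have : 1 - 3 * t <= (1 - t) ^+ 3 by rewrite !exprS expr0; nra.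
  by nra.
apply: le_trans h1 _.
by rewrite mulrCA (ler_wpM2l (ltW x0)).
Qed.

Theorem corollary2 (R : realType) :
  exists b : R, exists N : nat, forall n : nat, (N <= n)%N ->
    ((1 / (n%:R + 1))%:E <= min_density R n 1)%E /\
    (min_density R n 1 <=
       ((1 + b * ln (ln n%:R) / ln n%:R) * (1 / (n%:R + 1)))%:E)%E.
Proof.
have [N0 N0P] := scale_of_dimension.
(* The constant is 80 * 24, from [density_slack] and [lnln_over_ln_ge]. *)
exists 1920, N0 => n /N0P[l [l2 ln_ nl]]; split.
  by apply: le_ereal_inf_tmp => _ [C iC <-]; exact: density_ge.
have [D [Ddom Dcard]] := hypercube_dominating l2 ln_.
apply: (@le_trans _ _ (density R (parity_code D))).
  by apply: ereal_inf_lbound; exists (parity_code D) => //; exact: identifying_parity_code.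
apply: le_trans (density_parity_code_le _ _) _; rewrite lee_fin.
have P0 : 0 < 2 ^+ l :> R by rewrite exprn_gt0.
pose t : R := (2 ^+ l)^-1.
have Pt : 2 ^+ l * t = 1 by rewrite divff// gt_eqF.
have t0 : 0 < t by rewrite invr_gt0.
have t4 : 4 * t <= 1.
  rewrite -[leRHS]Pt ler_pM2r// -natrX ler_nat.
  by apply: leq_trans (_ : 2 ^ 2 <= _)%N => //; rewrite leq_exp2l.
have Pn : (2 ^ l <= n)%N.
  by apply: leq_trans ln_; rewrite leq_exp2l//; have := ltn_expl l (ltnSn 1); nia.
have xt : 1 <= n%:R * t by rewrite -{1}Pt ler_pM2r// -natrX ler_nat.
have n0 : 0 < n%:R :> R by nra.
apply: (@le_trans _ _ ((1 + 80 * t) * (1 / (n%:R + 1)))); last first.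
  have := lnln_over_ln_ge R l2 ln_ nl; rewrite invfM -/t => h.
  by rewrite ler_wpM2r// -mulrA; lra.
apply: le_trans (density_slack t0 t4 xt).
have q0 : 0 < 1 - t by lra.
have M0 : 0 < (1 - t) ^+ 3 by rewrite exprn_gt0.
(* This is [Dcard] divided by the cube of 2^l, as 2^l - 1 = 2^l (1 - t). *)
have le3 : #|D|%:R * n%:R * (1 - t) ^+ 3 <= 2 ^+ n :> R.
  rewrite -(ler_pM2r (exprn_gt0 3 P0)).
  have : ((#|D| * n * (2 ^ l).-1 ^ 3)%:R : R) <= (2 ^ n * (2 ^ l) ^ 3)%:R by rewrite ler_nat.
  rewrite !natrM !natrX.
  have -> : ((2 ^ l).-1%:R : R) = 2 ^+ l * (1 - t).
    by rewrite mulrBr Pt mulr1 -natrX -subn1 natrB// expn_gt0.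
  by move: (2 ^+ l) (2 ^+ n) => P Q; lra.
rewrite ler_pdivrMr ?exprn_gt0// -invfM mulrC ler_pdivlMr ?mulr_gt0//.
by rewrite [(1 - t) ^+ 3 * _]mulrC mulrA.
Qed.
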